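(* There is an algorithm which, given a finite group $G$ as input, outputs whether $G$ is chiral. That is, chirality of finite groups is a decidable (recursive) property.
   Context: A finite group is given as input by, for example, its multiplication table. A word $w$ in $k$ variables is an element of the free group on $x_1,\dots,x_k$. For a group $G$, $w$ induces by evaluation a map $w:G^{(k)}\to G$, where $G^{(k)}$ is the direct product of $k$ copies of $G$; its image is denoted $G_w$ (not assumed closed under inverses). A pair $(G,w)$ is chiral if $G_w\neq G_{w^{-1}}$, equivalently if the set of inverses of elements of $G_w$ is not equal to $G_w$. A group $G$ is chiral if $(G,w)$ is chiral for some word $w$ in some finite number of variables. *)

(* Defs.v *)
From HB Require Import structures.
From mathcomp Require Import all_boot all_fingroup.

Set Implicit Arguments.
Unset Strict Implicit.
Unset Printing Implicit Defensive.

(** * The free group on [x_0, ..., x_(k-1)] *)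

(* The letter [(i, false)] is the variable [x_i], and [(i, true)] is its
   inverse. The free group is the set of reduced words, with concatenation
   followed by free reduction. *)
Definition letter (k : nat) : Type := ('I_k * bool)%type.
HB.instance Definition _ k := Choice.on (letter k).

Definition flip k (l : letter k) : letter k := (l.1, ~~ l.2).

Definition reduced k (s : seq (letter k)) : bool :=
  sorted (fun a b => b != flip a) s.

Record free_group (k : nat) := FreeWord {
  letters :> seq (letter k);
  letters_reduced : reduced letters
}.

HB.instance Definition _ k := [isSub for @letters k].
HB.instance Definition _ k := [Choice of free_group k by <:].

Definition push k (l : letter k) (s : seq (letter k)) : seq (letter k) :=
  if s is a :: s' then if a == flip l then s' else l :: s else [:: l].

Definition word_mul k (s t : seq (letter k)) : seq (letter k) :=
  foldr (@push k) t s.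

Definition word_inv k (s : seq (letter k)) : seq (letter k) :=
  rev (map (@flip k) s).

Section FreeGroup.

Variable k : nat.
Implicit Types (l : letter k) (s t u : seq (letter k)).

Lemma flipK : involutive (@flip k).
Proof. by case=> i b; rewrite /flip /= negbK. Qed.

Lemma push_reduced l s : reduced s -> reduced (push l s).
Proof.
case: s => [|a s] //= red_s; case: eqP => [_|/eqP ne_al] /=.
  exact: path_sorted red_s.
by rewrite ne_al.
Qed.

Lemma word_mul_reduced s t : reduced t -> reduced (word_mul s t).
Proof. by move=> red_t; elim: s => //= l s; apply: push_reduced. Qed.

Lemma word_inv_reduced s : reduced s -> reduced (word_inv s).
Proof.
rewrite /reduced /word_inv rev_sorted sorted_map; apply: sub_sorted => a b /=.
by apply: contra => /eqP/(can_inj flipK) ->; rewrite flipK.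
Qed.

Lemma pushK l s : reduced s -> push l (push (flip l) s) = s.
Proof.
case: s => [|a s] /=; first by rewrite eqxx.
rewrite flipK; case: eqP => [->|_] /=; last by rewrite eqxx.
by case: s => //= b s /andP[/negbTE->].
Qed.

Lemma word_mul_push l t u : reduced t -> reduced u ->
  word_mul (push l t) u = push l (word_mul t u).
Proof.
case: t => [|a t] //= red_t red_u; case: eqP => //= ->.
by rewrite pushK ?word_mul_reduced.
Qed.

Lemma word_mulA s t u : reduced t -> reduced u ->
  word_mul s (word_mul t u) = word_mul (word_mul s t) u.
Proof.
move=> red_t red_u; elim: s => //= l s IHs.
by rewrite word_mul_push ?word_mul_reduced // IHs.
Qed.

Lemma word_mul1 s : reduced s -> word_mul s [::] = s.
Proof.
elim: s => //= l s IHs red_s; rewrite IHs; last exact: path_sorted red_s.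
by case: s red_s {IHs} => //= a s /andP[/negbTE->].
Qed.

Lemma word_mulV s : word_mul (word_inv s) s = [::].
Proof.
elim: s => //= l s IHs.
by rewrite /word_inv /word_mul /= rev_cons foldr_rcons /= flipK eqxx.
Qed.

Lemma word_invK : involutive (@word_inv k).
Proof.
by move=> s; rewrite /word_inv map_rev revK -map_comp map_id_in // => l _; apply: flipK.
Qed.

Definition fg_one : free_group k := @FreeWord k [::] isT.
Definition fg_inv (w : free_group k) : free_group k :=
  FreeWord (word_inv_reduced (letters_reduced w)).
Definition fg_mul (w1 w2 : free_group k) : free_group k :=
  FreeWord (word_mul_reduced w1 (letters_reduced w2)).
Definition fg_gen (i : 'I_k) : free_group k := @FreeWord k [:: (i, false)] isT.

Lemma fg_mulA : associative fg_mul.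
Proof. by move=> x y z; apply/val_inj; apply: word_mulA; apply: letters_reduced. Qed.
Lemma fg_mul1 : left_id fg_one fg_mul.
Proof. by move=> x; apply/val_inj. Qed.
Lemma fg_mulr1 : right_id fg_one fg_mul.
Proof. by move=> x; apply/val_inj/word_mul1/letters_reduced. Qed.
Lemma fg_mulV : left_inverse fg_one fg_inv fg_mul.
Proof. by move=> x; apply/val_inj/word_mulV. Qed.
Lemma fg_mulrV : right_inverse fg_one fg_inv fg_mul.
Proof.
by move=> x; apply/val_inj; rewrite /= -[X in word_mul X _]word_invK word_mulV.
Qed.

HB.instance Definition _ := isGroup.Build (free_group k)
  fg_mulA fg_mul1 fg_mulr1 fg_mulV fg_mulrV.

End FreeGroup.

(** * Word maps and chirality *)

Local Open Scope group_scope.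

Definition letter_eval (gT : groupType) k (v : 'I_k -> gT) (l : letter k) : gT :=
  if l.2 then (v l.1)^-1 else v l.1.

Definition word_eval (gT : groupType) k (v : 'I_k -> gT) (w : free_group k) : gT :=
  \prod_(l <- letters w) letter_eval v l.

Lemma word_eval_gen (gT : groupType) k (v : 'I_k -> gT) i :
  word_eval v (fg_gen i) = v i.
Proof. by rewrite /word_eval big_seq1. Qed.

Lemma word_evalM (gT : groupType) k (v : 'I_k -> gT) :
  {morph word_eval v : w1 w2 / w1 * w2}.
Proof.
case=> s1 red_s1 [s2 red_s2]; rewrite /word_eval /= /word_mul => {red_s1 red_s2}.
elim: s1 => [|l s1 IHs1] /=; first by rewrite big_nil mul1g.
rewrite big_cons -mulgA -IHs1; case: (foldr _ _ _) => [|a s] /=.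
  by rewrite big_seq1 big_nil mulg1.
case: eqP => [->|_]; last by rewrite big_cons.
rewrite big_cons mulgA /letter_eval /=; case: l.2 => /=.
  by rewrite mulVg mul1g.
by rewrite mulgV mul1g.
Qed.

(* The set [G_w] of values of [w] on [G]. *)
Definition word_image (gT : finGroupType) k (w : free_group k) : {set gT} :=
  [set word_eval v w | v : {ffun 'I_k -> gT}].

Definition chiral_pair (gT : finGroupType) k (w : free_group k) : Prop :=
  word_image gT w <> word_image gT w^-1.

Definition chiral (gT : finGroupType) : Prop :=
  exists (k : nat) (w : free_group k), chiral_pair gT w.

Close Scope group_scope.

(** * Partial recursive functions *)

Inductive recfun : nat -> Type :=
| Rzero n : recfun n
| Rsucc : recfun 1
| Rproj n (i : 'I_n) : recfun n
| Rcomp m n (f : recfun m) (g : 'I_m -> recfun n) : recfun n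
| Rprec n (f : recfun n) (g : recfun n.+2) : recfun n.+1
| Rmu n (f : recfun n.+1) : recfun n.

(* [computes p v y]: the partial function denoted by [p] is defined at [v],
   with value [y].
   - [Rprec f g] is the function [F] with [F (0, v) = f v] and
     [F (i + 1, v) = g (i, F (i, v), v)]; [h i] below is [F (i, v)].
   - [Rmu f] maps [v] to the least [y] such that [f (y, v) = 0], and is
     defined only if [f (i, v)] is defined for all [i < y]. *)
Fixpoint computes n (p : recfun n) : n.-tuple nat -> nat -> Prop :=
  match p in recfun n return n.-tuple nat -> nat -> Prop with
  | Rzero _ => fun _ y => y = 0
  | Rsucc => fun v y => y = (thead v).+1
  | Rproj _ i => fun v y => y = tnth v i
  | Rcomp m _ f g => fun v y => exists2 u : m.-tuple nat,
      forall i, computes (g i) v (tnth u i) & computes f u y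
  | Rprec _ f g => fun v y => exists h : nat -> nat,
      [/\ computes f [tuple of behead v] (h 0),
          forall i, i < thead v ->
            computes g [tuple of i :: h i :: behead v] (h i.+1)
        & y = h (thead v)]
  | Rmu _ f => fun v y =>
      computes f [tuple of y :: v] 0 /\
      forall i, i < y -> exists z, computes f [tuple of i :: v] z.+1
  end.

Lemma computes_functional n (p : recfun n) v y1 y2 :
  computes p v y1 -> computes p v y2 -> y1 = y2.
Proof.
elim: p v y1 y2 => {n} [n|| n i|m n f IHf g IHg|n f IHf g IHg|n f IHf] v y1 y2 /=;
  try by move=> -> ->.
- move=> [u1 gu1 fu1] [u2 gu2 fu2]; suff eq_u: u1 = u2.
    by rewrite eq_u in fu1; apply: IHf fu1 fu2.
  by apply: eq_from_tnth => i; apply: IHg (gu1 i) (gu2 i).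
- move=> [h1 [f1 g1 ->]] [h2 [f2 g2 ->]].
  have: forall i, i <= thead v -> h1 i = h2 i.
    elim=> [_|i IHi lt_i]; first exact: IHf f1 f2.
    have:= g1 i lt_i; rewrite (IHi (ltnW lt_i)) => g1i.
    exact: IHg g1i (g2 i lt_i).
  exact.
- move=> [f1 lt1] [f2 lt2]; case: (ltngtP y1 y2) => // lt_y.
    by have [z fz] := lt2 _ lt_y; have := IHf _ _ _ f1 fz.
  by have [z fz] := lt1 _ lt_y; have := IHf _ _ _ f2 fz.
Qed.

(** * Finite groups as inputs *)

Definition lists_group (gT : finGroupType) (s : seq gT) : Prop :=
  uniq s /\ forall x : gT, x \in s.

(* The multiplication table of [gT], for the numbering of its elements by
   their positions in [s]. *)
Definition mult_table (gT : finGroupType) (s : seq gT) : seq (seq nat) :=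
  [seq [seq index (x * y)%g s | y <- s] | x <- s].

Definition table_code (t : seq (seq nat)) : nat :=
  CodeSeq.code [seq CodeSeq.code r | r <- t].

(* A property of finite groups is decidable if some partial recursive function
   is defined at the code of every multiplication table of every finite group,
   and returns 1 if the group has the property, and 0 otherwise. *)
Definition decidable_property (P : finGroupType -> Prop) : Prop :=
  exists p : recfun 1, forall (gT : finGroupType) (s : seq gT),
    lists_group s ->
    let input := [tuple table_code (mult_table s)] in
    (P gT -> computes p input 1) /\ (~ P gT -> computes p input 0).

(* Main.v *)
From mathcomp Require Import all_boot all_fingroup cyclic.
Require Import Defs.

Set Implicit Arguments.
Unset Strict Implicit.
Unset Printing Implicit Defensive.

(** Write [n] for the order of the group [G]. Whether [G] is chiral depends only
    on word maps in [n] variables: if a value [g] of [w] has no inverse among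
    the values of [w], identify the variables of [w] that take the same value
    in some evaluation of [w] to [g]; the word obtained has at most [n]
    variables, still takes the value [g], and takes no new values. So the
    variables may be taken to be the elements of [G] themselves, and a word
    then defines a map from assignments [phi : G -> G] to [G]. Since [G] is
    finite, inverses are positive powers, so positive words define all these
    maps; and there are at most [n ^ (n ^ n)] of them, so cutting out the
    segment between two prefixes that define the same map makes any positive
    word shorter than this bound without changing its map. Hence
    ([chiral_short_word]) [G] is chiral if and only if there are a positive
    word [xs] of length less than [n ^ (n ^ n)] and an assignment [phi] such
    that, for all assignments [psi], the product of the values of [xs] at [phi]
    and [psi] is not 1.

    This is a statement with bounded quantifiers only. Words and assignments
    are represented by the base-[n] digits of natural numbers, which makes it
    an arithmetical condition on the code of the multiplication table
    ([chiral_search], [chiral_searchP]). It is computed by a recursive function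
    because total recursive functions are closed under arithmetic operations
    and bounded quantification ([recursive_chiral_search]). *)

(** * Total recursive functions *)

(** The argument is a function of lists, of which only the values at lists of
    length [n] matter. The list serves as an environment of de Bruijn
    variables: [head 0 v] is the innermost variable, and [behead v] is the
    environment outside its binder. Closure properties are stated for functions
    of a common environment, so that a program is shown recursive by following
    the syntax of its body. *)
Definition recursive n (f : seq nat -> nat) : Prop :=
  exists p : recfun n, forall v : n.-tuple nat, computes p v (f v).

Lemma recursive_ext n f g : f =1 g -> recursive n f -> recursive n g.
Proof. by move=> fg [p pP]; exists p => v; rewrite -fg. Qed.

Lemma recursive_succ n f : recursive n f -> recursive n (fun v => (f v).+1).
Proof.
case=> p pP; exists (Rcomp Rsucc (fun=> p)) => v.
by exists [tuple f v] => // i; rewrite ord1 tnth0.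
Qed.

Lemma recursive_const n c : recursive n (fun=> c).
Proof. by elim: c => [|c IHc]; [exists (Rzero n) | apply: recursive_succ]. Qed.

Lemma recursive_head n : recursive n.+1 (head 0).
Proof. by exists (Rproj ord0) => v; rewrite /= (tnth_nth 0) nth0. Qed.

Lemma recursive_weaken n f :
  recursive n f -> recursive n.+1 (fun v => f (behead v)).
Proof.
case=> p pP; exists (Rcomp p (fun i => Rproj (lift ord0 i))) => v.
exists [tuple of behead v]; last exact: pP.
by move=> i /=; rewrite !(tnth_nth 0) /= nth_behead.
Qed.

(** Inserts a variable just below the innermost one: this discards the
    accumulator of a recursion whose step only uses the loop counter. *)
Lemma recursive_weaken_under_head n f :
  recursive n.+1 f ->
  recursive n.+2 (fun v => f (head 0 v :: behead (behead v))).
Proof.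
case=> p pP; exists (Rcomp p (fun i : 'I_n.+1 => Rproj
  (if unlift ord0 i is Some j then lift ord0 (lift ord0 j) else ord0))) => v.
exists [tuple of head 0 v :: behead (behead v)].
  move=> i /=; case: unliftP => [j|] ->; rewrite !(tnth_nth 0) /= ?nth0 //.
  by rewrite !nth_behead.
exact: (pP [tuple of head 0 v :: behead (behead v)]).
Qed.

Lemma recursive_iteri n N f (g : seq nat -> nat -> nat -> nat) :
    recursive n N -> recursive n f ->
    recursive n.+2
      (fun v => g (behead (behead v)) (head 0 v) (head 0 (behead v))) ->
  recursive n (fun v => iteri (N v) (g v) (f v)).
Proof.
case=> pN NP [pf fP] [pg gP].
exists (Rcomp (Rprec pf pg)
          (fun i => if unlift ord0 i is Some j then Rproj j else pN)) => v.
exists [tuple of N v :: v] => [i|].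
  by case: unliftP => [j|] ->; rewrite ?tnth0 ?tnthS //=.
exists (fun i => iteri i (g v) (f v)).
have bv : [tuple of behead [tuple of N v :: v]] = v by apply/val_inj.
by split=> //=; rewrite bv; apply: fP.
Qed.

Lemma recursive_pred n f :
  recursive n f -> recursive n (fun v => (f v).-1).
Proof.
move=> Hf; apply: (@recursive_ext _ (fun v => iteri (f v) (fun i _ => i) 0)).
  by move=> v; case: (f v).
apply: recursive_iteri => //; first exact: recursive_const.
exact: recursive_head.
Qed.

(* Solves the goals for variables, for constants, and for hypotheses used under
   additional binders. *)
Ltac rec_leaf :=
  lazymatch goal with
  | |- recursive _ (head 0) => exact: recursive_head
  | |- recursive _ (fun v => head 0 v) => exact: recursive_head
  | |- recursive _ (fun=> ?c) => exact: recursive_const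
  | |- recursive _ (fun v => ?f (behead (@?e v))) =>
      refine (@recursive_weaken _ (fun v => f (e v)) _); rec_leaf
  | _ => assumption
  end.

Lemma recursive_iter n N f (g : seq nat -> nat -> nat) :
    recursive n N -> recursive n f ->
    recursive n.+1 (fun v => g (behead v) (head 0 v)) ->
  recursive n (fun v => iter (N v) (g v) (f v)).
Proof.
move=> HN Hf Hg.
apply: (@recursive_ext _ (fun v => iteri (N v) (fun=> g v) (f v))).
  by move=> v; elim: (N v) => //= m ->.
by apply: recursive_iteri => //; apply: recursive_weaken Hg.
Qed.

Lemma recursive_add n f g :
  recursive n f -> recursive n g -> recursive n (fun v => f v + g v).
Proof.
move=> Hf Hg; apply: (@recursive_ext _ (fun v => iter (f v) succn (g v))).
  by move=> v; rewrite iter_succn addnC.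
by apply: recursive_iter => //; apply/recursive_succ/recursive_head.
Qed.

Lemma recursive_sub n f g :
  recursive n f -> recursive n g -> recursive n (fun v => f v - g v).
Proof.
move=> Hf Hg; apply: (@recursive_ext _ (fun v => iter (g v) predn (f v))).
  by move=> v; rewrite iter_predn.
by apply: recursive_iter => //; apply/recursive_pred/recursive_head.
Qed.

Lemma recursive_mul n f g :
  recursive n f -> recursive n g -> recursive n (fun v => f v * g v).
Proof.
move=> Hf Hg; apply: (@recursive_ext _ (fun v => iter (f v) (addn (g v)) 0)).
  by move=> v; rewrite iter_addn_0 mulnC.
apply: recursive_iter => //; first exact: recursive_const.
by apply: recursive_add; rec_leaf.
Qed.

Lemma recursive_leq n f g :
  recursive n f -> recursive n g -> recursive n (fun v => f v <= g v).
Proof.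
move=> Hf Hg; apply: (@recursive_ext _ (fun v => 1 - (f v - g v))).
  by move=> v; rewrite /leq; case: (f v - g v).
by apply: recursive_sub; [apply: recursive_const | apply: recursive_sub].
Qed.

Lemma recursive_and n (a b : seq nat -> bool) :
  recursive n a -> recursive n b -> recursive n (fun v => a v && b v).
Proof.
move=> Ha Hb; apply: (@recursive_ext _ (fun v => a v * b v)).
  by move=> v; rewrite mulnb.
exact: recursive_mul.
Qed.

Lemma recursive_not n (a : seq nat -> bool) :
  recursive n a -> recursive n (fun v => ~~ a v).
Proof.
move=> Ha; apply: (@recursive_ext _ (fun v => 1 - a v)).
  by move=> v; case: (a v).
by apply: recursive_sub => //; apply: recursive_const.
Qed.

Lemma recursive_eq n f g :
  recursive n f -> recursive n g -> recursive n (fun v => f v == g v).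
Proof.
move=> Hf Hg.
apply: (@recursive_ext _ (fun v => (f v <= g v) && (g v <= f v))).
  by move=> v; rewrite -eqn_leq.
by apply: recursive_and; apply: recursive_leq.
Qed.

Lemma recursive_count n N (p : seq nat -> nat -> bool) :
    recursive n N -> recursive n.+1 (fun v => p (behead v) (head 0 v)) ->
  recursive n (fun v => count (p v) (iota 0 (N v))).
Proof.
move=> HN Hp.
apply: (@recursive_ext _ (fun v => iteri (N v) (fun i m => p v i + m) 0)).
  move=> v; elim: (N v) => // m IHm.
  by rewrite [LHS]/= IHm -[in RHS]addn1 iotaD count_cat /= addn0 addnC.
apply: recursive_iteri => //; first exact: recursive_const.
apply: recursive_add; last by rec_leaf.
exact: recursive_weaken_under_head Hp.
Qed.

Lemma recursive_has n N (p : seq nat -> nat -> bool) :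
    recursive n N -> recursive n.+1 (fun v => p (behead v) (head 0 v)) ->
  recursive n (fun v => has (p v) (iota 0 (N v))).
Proof.
move=> HN Hp.
apply: (@recursive_ext _ (fun v => 0 < count (p v) (iota 0 (N v)))).
  by move=> v; rewrite has_count.
apply: recursive_leq; first exact: recursive_const.
exact: recursive_count.
Qed.

Lemma recursive_all n N (p : seq nat -> nat -> bool) :
    recursive n N -> recursive n.+1 (fun v => p (behead v) (head 0 v)) ->
  recursive n (fun v => all (p v) (iota 0 (N v))).
Proof.
move=> HN Hp.
apply: (@recursive_ext _ (fun v => ~~ has (fun i => ~~ p v i) (iota 0 (N v)))).
  by move=> v; rewrite has_predC negbK.
by apply/recursive_not/recursive_has => //; apply: recursive_not.
Qed.

Lemma recursive_exp n f g :
  recursive n f -> recursive n g -> recursive n (fun v => f v ^ g v).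
Proof.
move=> Hf Hg; apply: (@recursive_ext _ (fun v => iter (g v) (muln (f v)) 1)).
  by move=> v; rewrite iter_muln_1.
apply: recursive_iter => //; first exact: recursive_const.
by apply: recursive_mul; rec_leaf.
Qed.

Lemma count_gtn_iota k m : k <= m -> count (gtn k) (iota 0 m) = k.
Proof.
move=> le_km; rewrite -size_filter (@filter_iota_ltn 0 m k) //.
by rewrite size_iota.
Qed.

Lemma recursive_div n f g :
  recursive n f -> recursive n g -> recursive n (fun v => f v %/ g v).
Proof.
move=> Hf Hg.
(* The factor [0 < g v] gives the convention that [m %/ 0 = 0]. *)
apply: (@recursive_ext _ (fun v =>
  (0 < g v) * count (fun i => i.+1 * g v <= f v) (iota 0 (f v)))).
  move=> v; have [->|g_gt0] := posnP (g v); first by rewrite divn0.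
  rewrite mul1n -[RHS](count_gtn_iota (leq_div (f v) (g v))).
  by apply: eq_count => i; rewrite /= leq_divRL.
apply: recursive_mul.
  by apply: recursive_leq => //; apply: recursive_const.
apply: recursive_count => //; apply: recursive_leq; last by rec_leaf.
by apply: recursive_mul; [apply: recursive_succ|]; rec_leaf.
Qed.

Lemma recursive_mod n f g :
  recursive n f -> recursive n g -> recursive n (fun v => f v %% g v).
Proof.
move=> Hf Hg; apply: (@recursive_ext _ (fun v => f v - f v %/ g v * g v)).
  by move=> v; rewrite {1}(divn_eq (f v) (g v)) addKn.
by apply: recursive_sub => //; apply: recursive_mul => //; apply: recursive_div.
Qed.

Ltac rec_step :=
  first
  [ rec_leaf
  | apply: recursive_and | apply: recursive_not
  | apply: recursive_eq | apply: recursive_leq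
  | apply: recursive_has | apply: recursive_all | apply: recursive_count
  | apply: recursive_mod | apply: recursive_div
  | apply: recursive_exp | apply: recursive_mul
  | apply: recursive_iteri | apply: recursive_iter | apply: recursive_succ ].

(** * Decoding lists *)

(** The code of [x :: s] is [2 ^ x * (2 * code s + 1)], so the head of a list is
    the 2-adic valuation of its code, obtained by counting the powers of 2 that
    divide it. *)
Definition code_head c := count (fun i => c %% 2 ^ i.+1 == 0) (iota 0 c).
Definition code_tail c := c %/ 2 ^ (code_head c).+1.
Definition code_nth c i := code_head (iter i code_tail c).
(** Only the empty list has code 0, and the length of a list is at most its
    code, so it suffices to count the nonempty tails up to the code. *)
Definition code_size c := count (fun i => 0 < iter i code_tail c) (iota 0 c).

Lemma recursive_code_head n f :
  recursive n f -> recursive n (fun v => code_head (f v)).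
Proof. move=> Hf; rewrite /code_head; repeat rec_step. Qed.

Lemma recursive_code_tail n f :
  recursive n f -> recursive n (fun v => code_tail (f v)).
Proof.
move=> Hf; have Hh := recursive_code_head Hf.
by rewrite /code_tail; repeat rec_step.
Qed.

Lemma recursive_code_nth n f g :
  recursive n f -> recursive n g -> recursive n (fun v => code_nth (f v) (g v)).
Proof.
move=> Hf Hg; apply: recursive_code_head.
by apply: recursive_iter => //; apply/recursive_code_tail/recursive_head.
Qed.

Lemma recursive_code_size n f :
  recursive n f -> recursive n (fun v => code_size (f v)).
Proof.
move=> Hf; apply: recursive_count => //; apply: recursive_leq.
  exact: recursive_const.
apply: recursive_iter; try rec_leaf.
by apply/recursive_code_tail/recursive_head.
Qed.

Lemma code_head_cons x s : code_head (CodeSeq.code (x :: s)) = x.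
Proof.
set c := CodeSeq.code _.
have def_c : c = 2 ^ x * (CodeSeq.code s).*2.+1 by [].
have lt_xc : x <= c.
  by rewrite def_c (leq_trans (ltnW (@ltn_expl 2 x isT))) // leq_pmulr.
rewrite /code_head -[RHS](count_gtn_iota lt_xc).
apply: eq_count => i; rewrite -/(2 ^ i.+1 %| c) /= pfactor_dvdn ?def_c //.
  rewrite lognM ?expn_gt0 // pfactorK // logn_coprime ?addn0 //=.
  by rewrite coprime2n /= odd_double.
by rewrite muln_gt0 expn_gt0.
Qed.

Lemma code_tail_cons x s :
  code_tail (CodeSeq.code (x :: s)) = CodeSeq.code s.
Proof.
rewrite /code_tail code_head_cons /= expnSr divnMl ?expn_gt0 //.
by rewrite divn2 /= uphalf_double.
Qed.

Lemma iter_code_tail i s :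
  i <= size s -> iter i code_tail (CodeSeq.code s) = CodeSeq.code (drop i s).
Proof.
elim: i s => [|i IHi] [|x s] //= le_is.
by rewrite -iterS iterSr code_tail_cons IHi.
Qed.

Lemma code_nthE s i : i < size s -> code_nth (CodeSeq.code s) i = nth 0 s i.
Proof.
move=> lt_is; rewrite /code_nth iter_code_tail 1?ltnW //.
by rewrite (drop_nth 0) // code_head_cons.
Qed.

Lemma code_sizeE s : code_size (CodeSeq.code s) = size s.
Proof.
have le_code : size s <= CodeSeq.code s.
  elim: s => //= x s IHs; rewrite -[_.+1]mul1n leq_mul ?expn_gt0 //.
  by rewrite ltnS (leq_trans IHs) // -addnn leq_addr.
rewrite /code_size -[RHS](count_gtn_iota le_code); apply: eq_count => i /=.
have [lt_is|le_si] := ltnP i (size s).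
  by rewrite (iter_code_tail (ltnW lt_is)) (drop_nth 0) //= muln_gt0 expn_gt0.
rewrite -(subnK le_si) iterD iter_code_tail // drop_size.
suff ->: iter (i - size s) code_tail 0 = 0 by [].
by elim: (i - _) => //= m ->.
Qed.

(** * Numbers as finite sequences of digits *)

(** Base-[b] digits, rather than list codes, represent words and assignments:
    every number is then the code of a valid object, and all objects are
    reached below an explicit bound. *)
Definition digit b x j := (x %/ b ^ j) %% b.

Lemma digits_onto b m (d : nat -> nat) :
    (forall j, j < m -> d j < b) ->
  exists2 x, x < b ^ m & forall j, j < m -> digit b x j = d j.
Proof.
elim: m d => [|m IHm] d lt_db; first by exists 0.
have [x lt_x xE] :
    exists2 x, x < b ^ m & forall j, j < m -> digit b x j = d j.+1.
  by apply: (IHm (fun j => d j.+1)) => j; apply: (lt_db j.+1).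
have d0 := lt_db 0 isT; have b_gt0 := leq_ltn_trans (leq0n _) d0.
exists (x * b + d 0) => [|[|j] lt_jm].
- rewrite expnSr (@leq_trans (x.+1 * b)) ?leq_mul2r ?lt_x ?orbT //.
  by rewrite mulSnr ltn_add2l.
- by rewrite /digit divn1 modnMDl modn_small.
by rewrite /digit expnS divnMA divnMDl // (divn_small d0) addn0; apply: xE.
Qed.

(** * The search for a chiral word *)

Definition table_lookup c i j := code_nth (code_nth c i) j.

(** The value, in the group of order [n] with table [c] and identity [e], of the
    positive word of length [l] given by the digits of [w], under the
    assignment given by the digits of [x]. *)
Definition eval_code c n e l w x :=
  iteri l (fun j m => table_lookup c m (digit n x (digit n w j))) e.

(** Here [e] is the identity, recognized as the only idempotent, [l] and [w] are
    the length and the digits of the word, and [x], [y] are assignments. *)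
Definition chiral_search c :=
  let n := code_size c in
  has (fun e => (table_lookup c e e == e) &&
    has (fun l => has (fun w => has (fun x =>
      all (fun y => table_lookup c (eval_code c n e l w x)
                                   (eval_code c n e l w y) != e)
        (iota 0 (n ^ n)))
      (iota 0 (n ^ n))) (iota 0 (n ^ l))) (iota 0 (n ^ (n ^ n))))
  (iota 0 n).

Lemma recursive_chiral_search :
  recursive 1 (fun v => chiral_search (head 0 v)).
Proof.
rewrite /chiral_search /eval_code /table_lookup /digit.
by repeat first
  [apply: recursive_code_nth | apply: recursive_code_size | rec_step].
Qed.

(** * Chirality and short positive words *)

Section PositiveWords.

Local Open Scope group_scope.

Variable gT : finGroupType.
Implicit Types (xs ys : seq gT) (phi psi : {ffun gT -> gT}).

Lemma word_evalV k (v : 'I_k -> gT) w : word_eval v w^-1 = (word_eval v w)^-1.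
Proof.
apply: (mulgI (word_eval v w)); rewrite -word_evalM !mulgV.
by rewrite /word_eval big_nil.
Qed.

(** The values of [w^-1] are the inverses of those of [w]. If these two sets
    differ, in either direction, then some value of [w] has an inverse that is
    not a value of [w]. *)
Lemma chiral_pair_prod k (w : free_group k) :
  chiral_pair gT w <->
  exists u : {ffun 'I_k -> gT}, forall v : {ffun 'I_k -> gT},
    word_eval u w * word_eval v w != 1.
Proof.
split=> [ne_w|[u uP] eq_w]; last first.
  have: word_eval u w \in word_image gT w^-1 by rewrite -eq_w imset_f.
  by case/imsetP=> v _ uv; case/negP: (uP v); rewrite uv word_evalV mulVg.
have [/existsP[u /forallP uP]|] := boolP [exists u : {ffun 'I_k -> gT},
    [forall v : {ffun 'I_k -> gT}, word_eval u w * word_eval v w != 1]].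
  by exists u.
rewrite negb_exists => /forallP uP; case: ne_w.
have inv_w (u : {ffun 'I_k -> gT}) :
    exists v : {ffun 'I_k -> gT}, word_eval v w = (word_eval u w)^-1.
  have:= uP u; rewrite negb_forall => /existsP[v]; rewrite negbK => /eqP uv.
  by exists v; apply/esym/eqP; rewrite eq_invg_mul uv.
apply/setP=> x; apply/imsetP/imsetP=> -[u _ ->]; have [v vE] := inv_w u;
  by exists v; rewrite // word_evalV vE ?invgK.
Qed.

(** The variables are replaced by their values under [u], which identifies those
    with equal values, and an inverse letter [x^-1] by [#|gT|.-1] letters [x]:
    this exponent inverts all elements, so it works for all [phi] at once. *)
Lemma positive_word k (w : free_group k) (u : 'I_k -> gT) :
  exists xs, forall phi, word_eval (phi \o u) w = \prod_(x <- xs) phi x.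
Proof.
rewrite /word_eval; elim: (letters w) => [|[i b] s [xs xsE]].
  by exists [::] => phi; rewrite !big_nil.
exists (nseq (if b then #|gT|.-1 else 1%N) (u i) ++ xs) => phi.
rewrite big_cons big_cat xsE /= big_nseq iter_mulg_1; congr (_ * _).
rewrite /letter_eval; case: b => //=.
have gT_gt0 : 0 < #|gT| by apply/card_gt0P; exists 1.
apply/eqP; rewrite eq_invg_mul -expgS prednK // -cardsT.
by apply/eqP/expg_cardG; rewrite inE.
Qed.

Lemma word_of_seq xs : exists w : free_group #|gT|,
  forall v : 'I_#|gT| -> gT, word_eval v w = \prod_(x <- xs) v (enum_rank x).
Proof.
elim: xs => [|x xs [w wE]].
  by exists 1 => v; rewrite big_nil /word_eval big_nil.
exists (fg_gen (enum_rank x) * w) => v.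
by rewrite word_evalM word_eval_gen big_cons wE.
Qed.

(* The maps from assignments to [gT], and the graph on them in which positive
   words are the paths from the constant map 1. *)
Let T := {ffun {ffun gT -> gT} -> gT}.
Let step (h k : T) :=
  [exists x, k == [ffun phi : {ffun gT -> gT} => h phi * phi x]].

(** A path between two points of a finite graph can be made free of repetitions,
    and is then shorter than the number of vertices. *)
Lemma short_word xs :
  exists2 ys, size ys < #|gT| ^ (#|gT| ^ #|gT|) &
    forall phi, \prod_(x <- xs) phi x = \prod_(y <- ys) phi y.
Proof.
have conn : connect step [ffun=> 1]
    [ffun phi : {ffun gT -> gT} => \prod_(x <- xs) phi x].
  elim/last_ind: xs => [|xs x /connect_trans IHxs].
    apply: eq_connect0; apply/ffunP=> phi.
    by rewrite !ffunE big_nil.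
  apply: IHxs; apply/connect1/existsP; exists x; apply/eqP/ffunP=> phi.
  by rewrite !ffunE big_rcons.
(* The word can be read off from any path. *)
have read h p : path step h p -> exists2 ys, size ys = size p &
    forall phi, last h p phi = h phi * \prod_(y <- ys) phi y.
  elim: p h => [|k p IHp] h /=.
    by exists [::] => // phi; rewrite big_nil mulg1.
  case/andP=> /existsP[x /eqP def_k] /IHp[ys szy ysE].
  exists (x :: ys) => [|phi]; first by rewrite /= szy.
  by rewrite ysE def_k ffunE big_cons mulgA.
case/connectP: conn => p0 /shortenP[p /read[ys szy ysE] Up _] xsE.
exists ys => [|phi]; last first.
  by have:= ysE phi; rewrite -xsE !ffunE mul1g.
have <-: #|{: T}| = (#|gT| ^ (#|gT| ^ #|gT|))%N by rewrite !card_ffun.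
rewrite szy -[(size p).+1]/(size ([ffun=> 1] :: p)).
by rewrite -(card_uniqP Up) max_card.
Qed.

Lemma chiral_short_word :
  chiral gT <->
  exists2 xs, size xs < #|gT| ^ (#|gT| ^ #|gT|) &
    exists phi, forall psi,
      (\prod_(x <- xs) phi x) * (\prod_(x <- xs) psi x) != 1.
Proof.
split=> [[k [w /chiral_pair_prod[u uP]]]|[xs _ [phi phiP]]].
  have [xs0 xs0E] := positive_word w u; have [xs lt_xs xsE] := short_word xs0.
  (* The variables are now the values of [u], so the identity evaluates the
     word as [u] does. *)
  exists xs => //; exists [ffun x => x] => psi.
  have:= uP [ffun i => psi (u i)]; rewrite -!xsE -!xs0E.
  by congr (_ * _ != _); apply: eq_bigr => -[i b] _;
    rewrite /letter_eval /= !ffunE.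
have [w wE] := word_of_seq xs; exists #|gT|, w; apply/chiral_pair_prod.
exists [ffun i => phi (enum_val i)] => v; rewrite !wE.
have := phiP [ffun x => v (enum_rank x)].
by congr (_ * _ != _); apply: eq_bigr => x _; rewrite ffunE ?enum_rankK.
Qed.

End PositiveWords.

(** * Correctness of the search *)

Section SearchCorrect.

Local Open Scope group_scope.

Variables (gT : finGroupType) (s : seq gT).
Hypotheses (Us : uniq s) (s_all : forall x, x \in s).

Let n := size s.
Let c := table_code (mult_table s).

(** Group elements are represented by their positions in [s]. *)
Definition codes_fun (t : nat) (phi : {ffun gT -> gT}) :=
  forall x, digit n t (index x s) = index (phi x) s.

Definition codes_seq (w : nat) (xs : seq gT) :=
  forall j, j < size xs -> digit n w j = index (nth 1 xs j) s.

Lemma size_listing : n = #|gT|.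
Proof. by rewrite /n -(card_uniqP Us); apply: eq_card. Qed.

Lemma index_lt x : index x s < n.
Proof. by rewrite index_mem. Qed.

Lemma digit_lt t j : digit n t j < n.
Proof. by rewrite ltn_mod (leq_ltn_trans _ (index_lt 1)). Qed.

Lemma index_eq x y : (index x s == index y s) = (x == y).
Proof. by apply/eqP/eqP=> [/index_inj->|->]. Qed.

Lemma code_size_table : code_size c = n.
Proof. by rewrite code_sizeE !size_map. Qed.

Lemma table_lookupE x y :
  table_lookup c (index x s) (index y s) = index (x * y) s.
Proof.
rewrite /table_lookup /c /table_code /mult_table -map_comp.
rewrite code_nthE ?size_map ?index_lt // (nth_map 1) ?index_lt //= nth_index //.
by rewrite code_nthE ?size_map ?index_lt // (nth_map 1) ?index_lt // nth_index.
Qed.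

Lemma eval_codeE w xs t phi : codes_seq w xs -> codes_fun t phi ->
  eval_code c n (index 1 s) (size xs) w t = index (\prod_(x <- xs) phi x) s.
Proof.
move=> wE tE; rewrite /eval_code -[in RHS](take_size xs).
elim: {-2}(size xs) (leqnn (size xs)) => [|m IHm] lt_m.
  by rewrite take0 big_nil.
rewrite /= IHm 1?ltnW // wE // tE table_lookupE.
by rewrite (take_nth 1) // big_rcons.
Qed.

Lemma fun_code phi : exists2 t, t < (n ^ n)%N & codes_fun t phi.
Proof.
have [|t lt_t tE] := @digits_onto n n (fun j => index (phi (nth 1 s j)) s).
  by move=> j _; apply: index_lt.
by exists t => // x; rewrite tE ?index_lt // nth_index.
Qed.

Lemma code_fun t : exists phi, codes_fun t phi.
Proof.
exists [ffun x => nth 1 s (digit n t (index x s))] => x.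
by rewrite ffunE index_uniq ?digit_lt.
Qed.

Lemma seq_code xs : exists2 w, w < (n ^ size xs)%N & codes_seq w xs.
Proof. by apply: digits_onto => j _; apply: index_lt. Qed.

Lemma code_seq w l : exists2 xs, size xs = l & codes_seq w xs.
Proof.
exists (mkseq (fun j => nth 1 s (digit n w j)) l) => [|j];
  rewrite size_mkseq //.
by move=> lt_jl; rewrite nth_mkseq // index_uniq ?digit_lt.
Qed.

Lemma chiral_searchP : chiral gT <-> chiral_search c.
Proof.
apply: (iff_trans (chiral_short_word gT)).
rewrite /chiral_search code_size_table -size_listing.
split=> [[xs lt_xs [phi phiP]]|].
  have [w lt_w wE] := seq_code xs; have [t lt_t tE] := fun_code phi.
  apply/hasP; exists (index 1 s); first by rewrite mem_iota index_lt.
  rewrite table_lookupE mulg1 eqxx; apply/hasP; exists (size xs).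
    by rewrite mem_iota.
  apply/hasP; exists w; first by rewrite mem_iota.
  apply/hasP; exists t; first by rewrite mem_iota.
  apply/allP=> t' _; have [psi psiE] := code_fun t'.
  by rewrite (eval_codeE wE tE) (eval_codeE wE psiE) table_lookupE index_eq.
case/hasP=> e; rewrite mem_iota => lt_e /andP[].
have [x ->] : exists x, e = index x s by exists (nth 1 s e); rewrite index_uniq.
rewrite table_lookupE index_eq -{3}[x]mulg1 => /eqP/mulgI->.
case/hasP=> l; rewrite mem_iota => lt_l /hasP[w _].
case/hasP=> t _ /allP tP.
have [xs szxs wE] := code_seq w l; have [phi tE] := code_fun t.
exists xs; first by rewrite szxs.
exists phi => psi; have [t' lt_t' t'E] := fun_code psi.
have:= tP t'; rewrite mem_iota -szxs => /(_ lt_t').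
by rewrite (eval_codeE wE tE) (eval_codeE wE t'E) table_lookupE index_eq.
Qed.

End SearchCorrect.

Theorem theorem3p3 : decidable_property chiral.
Proof.
have [p pP] := recursive_chiral_search; exists p => gT s [Us s_all] input.
have p_search : computes p input (chiral_search (table_code (mult_table s))).
  exact: pP input.
have [chiral_found found_chiral] := chiral_searchP Us s_all.
split=> [/chiral_found found|not_chiral]; first by rewrite found in p_search.
suff /negbTE not_found : ~~ chiral_search (table_code (mult_table s)).
  by rewrite not_found in p_search.
by apply/negP=> /found_chiral.
Qed.
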